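(* Let $(A,\cdot_A,a_A)$ be a left-symmetric algebroid over $M$ and let $(A^c\ltimes_{L^*}A^*,[\cdot,\cdot]_S,\rho,\omega)$ be the corresponding symplectic Lie algebroid. Then the multiplication $\star$ on $\Gamma(A\oplus A^* )$ of the corresponding pre-symplectic algebroid, i.e. the one determined by $$\omega(e_1\star e_2,e_3)=\rho(e_1)\omega(e_2,e_3)+\tfrac12\rho(e_3)\omega(e_1,e_2)-\omega(e_2,[e_1,e_3]_S),\qquad e_1,e_2,e_3\in\Gamma(A\oplus A^* ),$$ is given, for all $x,y\in\Gamma(A)$ and $\xi,\eta\in\Gamma(A^* )$, by $$(x+\xi)\star(y+\eta)=x\cdot_Ay+\mathcal L_x\eta-R_y^*\xi-\tfrac12\,\mathrm d(x+\xi,y+\eta)_+,$$ where $(x+\xi,y+\eta)_+=\langle\xi,y\rangle+\langle\eta,x\rangle$.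
   Context: All vector bundles are real, of finite rank, over a fixed smooth manifold $M$; bundle maps cover the identity of $M$. A left-symmetric algebroid $(A,\cdot_A,a_A)$ is a vector bundle $A\to M$ with an $\mathbb R$-bilinear product $\cdot_A$ on $\Gamma(A)$ whose associator $x\cdot_A(y\cdot_Az)-(x\cdot_Ay)\cdot_Az$ is symmetric in $x,y$, and a bundle map $a_A:A\to TM$ with $x\cdot_A(fy)=f(x\cdot_Ay)+a_A(x)(f)y$ and $(fx)\cdot_Ay=f(x\cdot_Ay)$. Its sub-adjacent Lie algebroid $A^c=(A,[\cdot,\cdot]_A,a_A)$ has bracket $[x,y]_A=x\cdot_Ay-y\cdot_Ax$. For $x,y\in\Gamma(A)$, $\xi\in\Gamma(A^* )$: $\langle L_x^*\xi,y\rangle=a_A(x)\langle\xi,y\rangle-\langle\xi,x\cdot_Ay\rangle$; $\langle\mathcal L_x\xi,y\rangle=a_A(x)\langle\xi,y\rangle-\langle\xi,[x,y]_A\rangle$; $\langle R_x^*\xi,y\rangle=-\langle\xi,y\cdot_Ax\rangle$; and for $f\in C^\infty(M)$, $\mathrm df\in\Gamma(A^* )$ is given by $\langle\mathrm df,x\rangle=a_A(x)(f)$. The symplectic Lie algebroid $A^c\ltimes_{L^*}A^*$ is the bundle $A\oplus A^*$ with bracket $[x+\xi,y+\eta]_S=[x,y]_A+L_x^*\eta-L_y^*\xi$, anchor $\rho(x+\xi)=a_A(x)$ and symplectic form $\omega(x+\xi,y+\eta)=\langle\xi,y\rangle-\langle\eta,x\rangle$ (it is known that this is a symplectic Lie algebroid,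 i.e. a Lie algebroid with a nondegenerate closed 2-form). *)

(* Defs.v *)
From HB Require Import structures.
From mathcomp Require Import all_boot all_order all_algebra.
From mathcomp Require Import boolp classical_sets functions reals topology.
From mathcomp Require Import normedtype landau derive.

Set Implicit Arguments.
Unset Strict Implicit.
Unset Printing Implicit Defensive.

Import Order.TTheory GRing.Theory Num.Theory numFieldNormedType.Exports.

Local Open Scope classical_set_scope.
Local Open Scope ring_scope.

Lemma near_eq_differentiable (R : realType) (V W : normedModType R)
    (f g : V -> W) (x : V) :
  {near x, f =1 g} -> differentiable f x -> differentiable g x.
Proof.
move=> fg df; have [dc fE] := (diff_locallyP x f).1 df.
have E : g \o shift x = cst (g x) + 'd f x +o_ 0 id.
  apply/eqaddoP => e e0.
  have /(_ e e0) := (eqaddoP _ _ _ _).1 fE.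
  have fgx : \forall y \near 0, f (shift x y) = g (shift x y).
    by move: (fg); rewrite [X in X -> _](near_shift 0) subr0.
  apply: filterS2 fgx => y /= fgy.
  by rewrite !fctE /= fgy (nbhs_singleton fg).
have dgE := @diff_unique R _ _ g ('d f x) x dc E.
by apply/diff_locallyP; rewrite dgE.
Qed.

Section Smooth.
Context {R : realType} {n : nat}.
Implicit Types (U V : set 'rV[R]_n) (f g : 'rV[R]_n -> R).

Fixpoint diffn_on (k : nat) U f : Prop :=
  if k is k'.+1 then
    (forall x, U x -> differentiable f x) /\
    (forall i : 'I_n, diffn_on k' U ('D_('e_i) f))
  else True.

(* For open U this is C^oo on U: differentiability of all the iterated partial
   derivatives makes them all continuous. *)
Definition smooth_in U f : Prop := forall k, diffn_on k U f.

Lemma smooth_in_diff U f x : smooth_in U f -> U x -> differentiable f x.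
Proof. by move=> /(_ 1%N)[+ _]; exact. Qed.

Lemma smooth_in_derive U f i : smooth_in U f -> smooth_in U ('D_('e_i) f).
Proof. by move=> sf k; have [_] := sf k.+1; exact. Qed.

Lemma smooth_in_bigcup U f :
  (forall x, U x -> exists2 V, V x & smooth_in V f) -> smooth_in U f.
Proof.
move=> H k; elim: k f H => [//|k IH] f H /=; split=> [x Ux|i].
  by have [V Vx sf] := H x Ux; exact: smooth_in_diff sf Vx.
apply: IH => x /H[V Vx sf]; exists V => //; exact: smooth_in_derive.
Qed.

Lemma smooth_inS U V f : V `<=` U -> smooth_in U f -> smooth_in V f.
Proof. by move=> VU sf; apply: smooth_in_bigcup => x /VU Ux; exists U. Qed.

Lemma smooth_in_cst U (a : R) : smooth_in U (cst a).
Proof.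
move=> k; elim: k a => [//|k IH] a /=; split=> [x _|i].
  exact: differentiable_cst.
rewrite (_ : 'D_('e_i) (cst a) = cst 0) //.
by apply/funext => x; rewrite derive_cst.
Qed.

Lemma eq_diffn_on k U f g : open U -> {in U, f =1 g} ->
  diffn_on k U f -> diffn_on k U g.
Proof.
move=> oU; elim: k f g => [//|k IH] f g fg /= [df sf].
have fgn x : U x -> \forall y \near x, f y = g y.
  move=> Ux; have : nbhs x U by exact: open_nbhs_nbhs.
  by apply: filterS => y Uy; apply: fg; rewrite inE.
split=> [x Ux|i]; first exact: near_eq_differentiable (fgn x Ux) (df x Ux).
apply: (IH ('D_('e_i) f)) => // x.
by rewrite inE => Ux; apply: near_eq_derive; exact: fgn.
Qed.

Lemma diffn_onD k U f g : open U ->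
  diffn_on k U f -> diffn_on k U g -> diffn_on k U (f + g).
Proof.
move=> oU; elim: k f g => [//|k IH] f g [df sf] [dg sg] /=.
split=> [x Ux|i]; first by apply: differentiableD; [exact: df|exact: dg].
apply: (@eq_diffn_on _ _ ('D_('e_i) f + 'D_('e_i) g)) => // [x|].
  by rewrite inE => Ux; rewrite deriveD //; apply: diff_derivable; [exact: df|exact: dg].
by apply: IH; [exact: sf|exact: sg].
Qed.

Lemma eq_smooth_in U f g : open U -> {in U, f =1 g} ->
  smooth_in U f -> smooth_in U g.
Proof. by move=> oU fg sf k; exact: eq_diffn_on fg (sf k). Qed.

Lemma diffn_onW k U f : diffn_on k.+1 U f -> diffn_on k U f.
Proof.
elim: k f => [//|k IH] f [df sf]; split => // i; apply: IH; exact: sf.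
Qed.

Lemma diffn_onM k U f g : open U ->
  diffn_on k U f -> diffn_on k U g -> diffn_on k U (f * g).
Proof.
move=> oU; elim: k f g => [//|k IH] f g sf sg.
have [df sdf] := sf; have [dg sdg] := sg.
split=> [x Ux|i]; first by apply: differentiableM; [exact: df|exact: dg].
apply: (@eq_diffn_on _ _ (f * 'D_('e_i) g + g * 'D_('e_i) f)) => // [x|].
  rewrite inE => Ux; rewrite deriveM //; apply: diff_derivable; [exact: df|exact: dg].
have fW := diffn_onW sf; have gW := diffn_onW sg.
by apply: diffn_onD => //; apply: IH => //; [exact: sdg|exact: sdf].
Qed.

Lemma diffn_on_sum (m k : nat) U (f : 'I_m -> 'rV[R]_n -> R) : open U ->
  (forall i, diffn_on k U (f i)) -> diffn_on k U (\sum_i f i).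
Proof.
move=> oU sf; elim/big_ind : _ => // [|g h sg sh].
  exact: (@smooth_in_cst U 0).
exact: diffn_onD.
Qed.

Lemma smooth_inD U f g : open U ->
  smooth_in U f -> smooth_in U g -> smooth_in U (f + g).
Proof. by move=> oU sf sg k; exact: diffn_onD. Qed.

Lemma smooth_inM U f g : open U ->
  smooth_in U f -> smooth_in U g -> smooth_in U (f * g).
Proof. by move=> oU sf sg k; exact: diffn_onM. Qed.

Lemma smooth_in_sum (m : nat) U (f : 'I_m -> 'rV[R]_n -> R) : open U ->
  (forall i, smooth_in U (f i)) -> smooth_in U (\sum_i f i).
Proof. by move=> oU sf k; apply: diffn_on_sum => // i; exact: sf. Qed.

Lemma differentiable_row (h : 'rV[R]_n -> 'rV[R]_n) (x : 'rV[R]_n) :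
  (forall j, differentiable (fun y => h y 0 j) x) -> differentiable h x.
Proof.
move=> dh; rewrite (_ : h = \sum_j (fun y => h y 0 j *: 'e_j)).
  by apply: differentiable_sum => j; exact: differentiableZl.
by apply/funext => y; rewrite fct_sumE -row_sum_delta.
Qed.

Lemma derive_comp_row (h : 'rV[R]_n -> 'rV[R]_n) g (x v : 'rV[R]_n) :
  (forall j, differentiable (fun y => h y 0 j) x) -> differentiable g (h x) ->
  'D_v (g \o h) x = \sum_j 'D_v (fun y => h y 0 j) x * 'D_('e_j) g (h x).
Proof.
move=> dh dg; have dhx := differentiable_row dh.
rewrite deriveE; last exact: differentiable_comp.
rewrite diff_comp //= [in LHS](row_sum_delta ('d h x v)) linear_sum.
apply: eq_bigr => j _; rewrite linearZ /= [in RHS]deriveE // deriveE //.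
congr (_ * _).
have @p : {linear 'rV[R]_n -> R}.
  by exists (fun N : 'rV[R]_n => N 0 j); do 2![eexists]; do ?[constructor];
     rewrite ?mxE// => ? *; rewrite ?mxE//; move=> ?; rewrite !mxE.
have pc : continuous p by exact: coord_continuous.
have -> : (fun y => h y 0 j) = p \o h by [].
rewrite (diff_comp dhx (linear_differentiable (h x) pc)).
by rewrite [RHS]/comp (diff_lin (h x) pc).
Qed.

Lemma smooth_in_comp U V (h : 'rV[R]_n -> 'rV[R]_n) g : open U ->
  (forall j, smooth_in U (fun y => h y 0 j)) -> (forall x, U x -> V (h x)) ->
  smooth_in V g -> smooth_in U (g \o h).
Proof.
move=> oU sh UV sg k; elim: k g sg => [//|k IH] g sg /=.
have dh x : U x -> forall j, differentiable (fun y => h y 0 j) x.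
  by move=> Ux j; exact: smooth_in_diff (sh j) Ux.
split=> [x Ux|i].
  apply: differentiable_comp; first by apply: differentiable_row; exact: dh.
  exact: smooth_in_diff sg (UV _ Ux).
apply: (@eq_diffn_on _ _ (\sum_j
  ('D_('e_i) (fun y => h y 0 j) * ('D_('e_j) g \o h)))) => // [x|].
  rewrite inE => Ux; rewrite derive_comp_row ?fct_sumE //; first exact: dh.
  exact: smooth_in_diff sg (UV _ Ux).
apply: diffn_on_sum => // j; apply: diffn_onM => //.
  exact: (smooth_in_derive i (sh j)).
by apply: IH; exact: smooth_in_derive.
Qed.

End Smooth.

(* Smooth n-dimensional manifolds without boundary; the atlas need not be
   maximal, and coordV c is only meaningful on the image of the chart c. *)
Record manifold (R : realType) (n : nat) := Manifold {
  point_of :> topologicalType;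
  manifold_hausdorff : hausdorff_space point_of;
  manifold_second_countable : @second_countable point_of;
  chart : Type;
  dom : chart -> set point_of;
  coord : chart -> point_of -> 'rV[R]_n;
  coordV : chart -> 'rV[R]_n -> point_of;
  chart_at : point_of -> chart;
  chart_atP : forall p, dom (chart_at p) p;
  dom_open : forall c, open (dom c);
  coord_open : forall c, open (coord c @` dom c);
  coordK : forall c p, dom c p -> coordV c (coord c p) = p;
  coord_cts : forall c p, dom c p -> {for p, continuous (coord c)};
  coordV_cts : forall c p, dom c p -> {for coord c p, continuous (coordV c)};
  transition_smooth : forall c d j,
    smooth_in (coord c @` (dom c `&` dom d))
      (fun v => coord d (coordV c v) 0 j)
}.
Arguments dom {R n m} c.
Arguments coord {R n m} c.
Arguments coordV {R n m} c.
Arguments chart_at {R n m} p.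

Section Manifold.
Context {R : realType} {n : nat} {M : manifold R n}.
Implicit Types (c d b : chart M) (p : M) (W : set M) (f g : M -> R).

Definition smooth_on W f : Prop :=
  forall c, smooth_in (coord c @` (dom c `&` W)) (f \o coordV c).

Lemma image_open c W : open W -> open (coord c @` (dom c `&` W)).
Proof.
move=> oW; rewrite openE => _ [p [cp Wp] <-]; rewrite /interior.
have imn : nbhs (coord c p) (coord c @` dom c).
  by apply: open_nbhs_nbhs; split; [exact: coord_open|exists p].
have Wn : nbhs (coord c p) (coordV c @^-1` W).
  apply: (coordV_cts cp); rewrite coordK //; exact: open_nbhs_nbhs.
apply: filterS2 imn Wn => _ [q cq <-] /=; rewrite coordK // => Wq.
by exists q.
Qed.

Lemma eq_smooth_on W f g : open W -> {in W, f =1 g} ->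
  smooth_on W f -> smooth_on W g.
Proof.
move=> oW fg sf c; apply: (eq_smooth_in _ _ (sf c)); first exact: image_open.
move=> x; rewrite inE => -[p [cp Wp] <-] /=; rewrite coordK //.
by apply: fg; rewrite inE.
Qed.

Lemma smooth_on_bigcup W f :
  (forall p, W p -> exists2 V, V p & smooth_on V f) -> smooth_on W f.
Proof.
move=> H c; apply: smooth_in_bigcup => _ [p [cp Wp] <-].
by have [V Vp sf] := H p Wp; exists (coord c @` (dom c `&` V)) => //; exists p.
Qed.

Lemma smooth_onS W V f : V `<=` W -> smooth_on W f -> smooth_on V f.
Proof.
move=> VW sf c; apply: smooth_inS (sf c).
by apply: image_subset => p [cp Vp]; split=> //; exact: VW.
Qed.

Lemma smooth_on_cst W (a : R) : smooth_on W (cst a).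
Proof. by move=> c; exact: (@smooth_in_cst _ _ _ a). Qed.

Lemma smooth_onD W f g : open W ->
  smooth_on W f -> smooth_on W g -> smooth_on W (f + g).
Proof.
move=> oW sf sg c; apply: (smooth_inD _ (sf c) (sg c)); exact: image_open.
Qed.

Lemma smooth_onM W f g : open W ->
  smooth_on W f -> smooth_on W g -> smooth_on W (f * g).
Proof.
move=> oW sf sg c; apply: (smooth_inM _ (sf c) (sg c)); exact: image_open.
Qed.

Lemma smooth_onN W f : open W -> smooth_on W f -> smooth_on W (- f).
Proof.
move=> oW sf; have := smooth_onM oW (@smooth_on_cst W (-1)) sf.
by apply: eq_smooth_on => // p _; rewrite !fctE mulN1r.
Qed.

Lemma smooth_on_sum m W (f : 'I_m -> M -> R) : open W ->
  (forall i, smooth_on W (f i)) -> smooth_on W (\sum_i f i).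
Proof.
move=> oW sf; elim/big_ind : _ => //; first exact: smooth_on_cst.
by move=> g h; exact: smooth_onD.
Qed.

Lemma smooth_on_coord c W (g : 'rV[R]_n -> R) : open W -> W `<=` dom c ->
  smooth_in (coord c @` W) g -> smooth_on W (g \o coord c).
Proof.
move=> oW Wc sg d; apply: (@smooth_in_comp _ _ _ (coord c @` W)
  (coord c \o coordV d)) => //; first exact: image_open.
- move=> j; apply: smooth_inS (@transition_smooth _ _ M d c j).
  by apply: image_subset => p [dp /Wc cp].
- by move=> _ [p [dp Wp] <-] /=; rewrite coordK //; exists p.
Qed.

Definition jac c d p : 'M[R]_n := 'J (coord d \o coordV c) (coord c p).

Lemma transition_differentiable c d p : dom c p -> dom d p ->
  forall j, differentiable (fun v => coord d (coordV c v) 0 j) (coord c p).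
Proof.
move=> cp dp j; apply: smooth_in_diff (@transition_smooth _ _ M c d j) _.
by exists p.
Qed.

Lemma jac_comp (W : normedModType R) (h : M -> W) c d p v : dom c p -> dom d p ->
  differentiable (h \o coordV d) (coord d p) ->
  'D_v (h \o coordV c) (coord c p) =
  'D_(v *m jac c d p) (h \o coordV d) (coord d p).
Proof.
move=> cp dp dh; pose t := coord d \o coordV c.
have dt : differentiable t (coord c p).
  by apply: differentiable_row; exact: transition_differentiable.
have tp : t (coord c p) = coord d p by rewrite /t /= coordK.
transitivity ('D_v ((h \o coordV d) \o t) (coord c p)).
  apply: near_eq_derive; have : nbhs (coord c p) (coord c @` (dom c `&` dom d)).
    apply: open_nbhs_nbhs; split; last by exists p.
    by apply: image_open; exact: dom_open.
  by apply: filterS => _ [q [cq dq] <-]; rewrite /t /= !coordK.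
rewrite -tp in dh *; rewrite deriveE; last exact: differentiable_comp.
by rewrite diff_comp // /jac -deriveEjacobian // [RHS]deriveE // deriveE.
Qed.

Lemma jacM b c d p : dom b p -> dom c p -> dom d p ->
  jac b c p *m jac c d p = jac b d p.
Proof.
move=> bp cp dp; apply/row_matrixP => i; rewrite !rowE mulmxA.
have dcd : differentiable (coord d \o coordV c) (coord c p).
  by apply: differentiable_row; exact: transition_differentiable.
have dbd : differentiable (coord d \o coordV b) (coord b p).
  by apply: differentiable_row; exact: transition_differentiable.
by rewrite -[RHS]deriveEjacobian // -[LHS]deriveEjacobian // (jac_comp _ bp cp).
Qed.

Lemma jac1 c p : dom c p -> jac c c p = 1%:M.
Proof.
move=> cp; apply/row_matrixP => i; rewrite !rowE mulmx1.
have dcc : differentiable (coord c \o coordV c) (coord c p).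
  by apply: differentiable_row; exact: transition_differentiable.
rewrite -deriveEjacobian // -[RHS](derive_id (coord c p)).
apply: near_eq_derive; have : nbhs (coord c p) (coord c @` dom c).
  by apply: open_nbhs_nbhs; split; [exact: coord_open|exists p].
by apply: filterS => _ [q cq <-]; rewrite /= coordK.
Qed.

Lemma jac_smooth c d i j : smooth_on (dom c `&` dom d) (fun p => jac c d p i j).
Proof.
have oW : open (dom c `&` dom d) by apply: openI; exact: dom_open.
have := smooth_in_derive i (@transition_smooth _ _ M c d j).
move=> /(smooth_on_coord oW (@subIsetl _ _ _)).
apply: eq_smooth_on => // p; rewrite inE => -[cp dp].
have dcd : differentiable (coord d \o coordV c) (coord c p).
  by apply: differentiable_row; exact: transition_differentiable.
have -> : jac c d p i j = (row i (jac c d p)) 0 j by rewrite [RHS]mxE.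
rewrite rowE.
rewrite -deriveEjacobian // derive_mx ?mxE //; exact: diff_derivable.
Qed.

Definition smooth_pred : {pred M -> R} := fun f => `[< smooth_on setT f >].

Lemma smooth_pred_subring : subring_closed smooth_pred.
Proof.
split; first by apply/asboolP; exact: smooth_on_cst.
- move=> f g /asboolP sf /asboolP sg; apply/asboolP.
  by apply: smooth_onD => //; [exact: openT|apply: smooth_onN => //; exact: openT].
- move=> f g /asboolP sf /asboolP sg; apply/asboolP.
  by apply: smooth_onM => //; exact: openT.
Qed.
HB.instance Definition _ :=
  GRing.isSubringClosed.Build (M -> R) smooth_pred smooth_pred_subring.

End Manifold.

Record smooth_fun (R : realType) (n : nat) (M : manifold R n) := SmoothFun {
  fun_of_smooth :> M -> R;
  _ : fun_of_smooth \in smooth_pred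
}.

Section SmoothFun.
Context {R : realType} {n : nat} {M : manifold R n}.

HB.instance Definition _ := [isSub for @fun_of_smooth R n M].
HB.instance Definition _ := [Choice of smooth_fun M by <:].
HB.instance Definition _ := GRing.SubChoice_isSubComPzRing.Build
  (M -> R) smooth_pred (smooth_fun M) (GRing.subringClosedP _).

Definition mk_smooth (f : M -> R) (sf : smooth_on setT f) : smooth_fun M :=
  SmoothFun (asboolT sf).

Definition smooth_cst (a : R) : smooth_fun M :=
  mk_smooth (@smooth_on_cst _ _ _ _ a).

Lemma smooth_funP (f : smooth_fun M) W : smooth_on W f.
Proof. by apply: smooth_onS (asboolW (valP f)). Qed.

End SmoothFun.

(* Real vector bundles over M, given by the family of their fibers and an atlas
   of local trivializations tmap; smoothness of the transition functions is
   tested on constant vectors. *)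
Record vbundle (R : realType) (n : nat) (M : manifold R n) := VBundle {
  fiber :> M -> vectType R;
  rank : nat;
  triv : Type;
  tdom : triv -> set M;
  tmap : forall (i : triv) (p : M), 'Hom(fiber p, 'rV[R]_rank);
  tinv : forall (i : triv) (p : M), 'Hom('rV[R]_rank, fiber p);
  triv_at : M -> triv;
  triv_atP : forall p, tdom (triv_at p) p;
  tdom_open : forall i, open (tdom i);
  tmapK : forall i p, tdom i p -> cancel (tmap i p) (tinv i p);
  tinvK : forall i p, tdom i p -> cancel (tinv i p) (tmap i p);
  triv_smooth : forall i j v l,
    smooth_on (tdom i `&` tdom j) (fun p => tmap j p (tinv i p v) 0 l)
}.
Arguments tdom {R n M _} i.
Arguments tmap {R n M _} i p.
Arguments tinv {R n M _} i p.
Arguments triv_at {R n M _} p.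

Section Tangent.
Context {R : realType} {n : nat} (M : manifold R n).
Implicit Types (c : chart M) (p : M).

(* The fiber at p is R^n, a tangent vector at p being represented by its
   coordinates in the chart chart_at p. *)
Definition tangent_map c p : 'Hom('rV[R]_n, 'rV[R]_n) :=
  linfun (mulmxr (jac (chart_at p) c p)).
Definition tangent_inv c p : 'Hom('rV[R]_n, 'rV[R]_n) :=
  linfun (mulmxr (jac c (chart_at p) p)).

Lemma tangent_mapK c p : dom c p -> cancel (tangent_map c p) (tangent_inv c p).
Proof.
move=> cp v; have bp := chart_atP p.
by rewrite !lfunE /= -mulmxA jacM // jac1 // mulmx1.
Qed.

Lemma tangent_invK c p : dom c p -> cancel (tangent_inv c p) (tangent_map c p).
Proof.
move=> cp v; have bp := chart_atP p.
by rewrite !lfunE /= -mulmxA jacM // jac1 // mulmx1.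
Qed.

Lemma tangent_smooth c d v l : smooth_on (dom c `&` dom d)
  (fun p => tangent_map d p (tangent_inv c p v) 0 l).
Proof.
have oW : open (dom c `&` dom d) by apply: openI; exact: dom_open.
apply: (@eq_smooth_on _ _ _ _ (\sum_k (cst (v 0 k) * (fun p => jac c d p k l)))).
- by [].
- move=> p; rewrite inE => -[cp dp]; have bp := chart_atP p.
  by rewrite !lfunE /= -mulmxA jacM // fct_sumE [RHS]mxE.
- apply: smooth_on_sum => // k; apply: smooth_onM => //.
    exact: smooth_on_cst.
  exact: jac_smooth.
Qed.

Definition tangent_bundle : vbundle M :=
  @VBundle R n M (fun _ => 'rV[R]_n) n (chart M) dom tangent_map tangent_inv
    chart_at (@chart_atP R n M) (@dom_open R n M) tangent_mapK tangent_invK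
    tangent_smooth.

End Tangent.

Section Bundle.
Context {R : realType} {n : nat} {M : manifold R n}.
Implicit Types (E F : vbundle M) (p : M).

Section Dual.
Variable E : vbundle M.

Definition dual_map_fun i p (f : 'Hom(E p, R^o)) : 'rV[R]_(rank E) :=
  \row_k f (tinv i p 'e_k).
Lemma dual_map_linear i p : linear (@dual_map_fun i p).
Proof.
by move=> a f g; apply/rowP => k; rewrite !mxE add_lfunE scale_lfunE.
Qed.
HB.instance Definition _ i p :=
  GRing.isLinear.Build R _ _ _ (@dual_map_fun i p) (@dual_map_linear i p).

Definition dual_inv_at i p (v : 'rV[R]_(rank E)) (y : E p) : R^o :=
  \sum_k v 0 k * tmap i p y 0 k.
Lemma dual_inv_at_linear i p v : linear (@dual_inv_at i p v).
Proof.
move=> a y z; rewrite /dual_inv_at scaler_sumr -big_split /=.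
by apply: eq_bigr => k _; rewrite linearP !mxE mulrDr mulrCA.
Qed.
HB.instance Definition _ i p v := GRing.isLinear.Build R _ _ _
  (@dual_inv_at i p v) (@dual_inv_at_linear i p v).

Definition dual_inv_fun i p (v : 'rV[R]_(rank E)) : 'Hom(E p, R^o) :=
  linfun (dual_inv_at i v).
Lemma dual_inv_linear i p : linear (@dual_inv_fun i p).
Proof.
move=> a v w; apply/lfunP => y; rewrite add_lfunE scale_lfunE !lfunE /=.
rewrite /dual_inv_at scaler_sumr -big_split /=.
by apply: eq_bigr => k _; rewrite !mxE mulrDl -mulrA.
Qed.
HB.instance Definition _ i p := GRing.isLinear.Build R _ _ _
  (@dual_inv_fun i p) (@dual_inv_linear i p).

Definition dual_map i p := linfun (@dual_map_fun i p).
Definition dual_inv i p := linfun (@dual_inv_fun i p).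

Lemma dual_invE i p v y :
  dual_inv i p v y = \sum_k v 0 k * tmap i p y 0 k :> R.
Proof. by rewrite /dual_inv lfunE /= /dual_inv_fun lfunE. Qed.

Lemma dual_mapE i p f k : dual_map i p f 0 k = f (tinv i p 'e_k) :> R.
Proof. by rewrite /dual_map lfunE /= mxE. Qed.

Lemma dual_mapK i p : tdom i p -> cancel (dual_map i p) (dual_inv i p).
Proof.
move=> ip f; apply/lfunP => y; rewrite dual_invE.
rewrite -[in RHS](tmapK ip y) [in RHS](row_sum_delta (tmap i p y)) !linear_sum.
by apply: eq_bigr => k _; rewrite dual_mapE !linearZ mulrC.
Qed.

Lemma dual_invK i p : tdom i p -> cancel (dual_inv i p) (dual_map i p).
Proof.
move=> ip v; apply/rowP => k; rewrite dual_mapE dual_invE (bigD1 k) //=.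
rewrite big1 ?addr0 => [|l lk]; rewrite tinvK // mxE ?eqxx ?mulr1 //.
by rewrite (negbTE lk) mulr0.
Qed.

Lemma dual_smooth i j v l : smooth_on (tdom i `&` tdom j)
  (fun p => dual_map j p (dual_inv i p v) 0 l).
Proof.
have oW : open (tdom i `&` tdom j) by apply: openI; exact: tdom_open.
apply: (@eq_smooth_on _ _ _ _
  (\sum_k (cst (v 0 k) * (fun p => tmap i p (tinv j p 'e_l) 0 k)))) => //.
  by move=> p _; rewrite dual_mapE dual_invE fct_sumE.
apply: smooth_on_sum => // k; apply: smooth_onM => //.
  exact: smooth_on_cst.
rewrite setIC; exact: triv_smooth.
Qed.

Definition dual_bundle : vbundle M :=
  @VBundle R n M (fun p => 'Hom(E p, R^o)) (rank E) (triv E) tdom dual_map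
    dual_inv triv_at (@triv_atP _ _ _ E) (@tdom_open _ _ _ E) dual_mapK
    dual_invK dual_smooth.

End Dual.

Section Whitney.
Variables E F : vbundle M.
Let T := (triv E * triv F)%type.
Let D (i : T) : set M := tdom i.1 `&` tdom i.2.

Definition sum_map_fun (i : T) p (u : E p * F p) : 'rV[R]_(rank E + rank F) :=
  row_mx (tmap i.1 p u.1) (tmap i.2 p u.2).
Lemma sum_map_linear i p : linear (@sum_map_fun i p).
Proof.
by move=> a u v; rewrite /sum_map_fun /= !linearP scale_row_mx add_row_mx.
Qed.
HB.instance Definition _ i p := GRing.isLinear.Build R _ _ _
  (@sum_map_fun i p) (@sum_map_linear i p).

Definition sum_inv_fun (i : T) p (v : 'rV[R]_(rank E + rank F)) :
  (E p * F p)%type := (tinv i.1 p (lsubmx v), tinv i.2 p (rsubmx v)).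
Lemma sum_inv_linear i p : linear (@sum_inv_fun i p).
Proof. by move=> a u v; rewrite /sum_inv_fun !linearP. Qed.
HB.instance Definition _ i p := GRing.isLinear.Build R _ _ _
  (@sum_inv_fun i p) (@sum_inv_linear i p).

Definition sum_map i p := linfun (@sum_map_fun i p).
Definition sum_inv i p := linfun (@sum_inv_fun i p).

Lemma sum_atP p : D (triv_at p, triv_at p) p.
Proof. by split; exact: triv_atP. Qed.
Lemma sum_open i : open (D i).
Proof. by apply: openI; exact: tdom_open. Qed.

Lemma sum_mapK i p : D i p -> cancel (sum_map i p) (sum_inv i p).
Proof.
move=> [i1 i2] [u v]; rewrite !lfunE /= /sum_inv_fun row_mxKl row_mxKr.
by rewrite !tmapK.
Qed.

Lemma sum_invK i p : D i p -> cancel (sum_inv i p) (sum_map i p).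
Proof.
by move=> [i1 i2] v; rewrite !lfunE /= /sum_map_fun /= !tinvK // hsubmxK.
Qed.

Lemma sum_smooth i j v l : smooth_on (D i `&` D j)
  (fun p => sum_map j p (sum_inv i p v) 0 l).
Proof.
have oW : open (D i `&` D j) by apply: openI; exact: sum_open.
pose g p := sum_map_fun j (sum_inv_fun i p v) 0 l.
apply: (@eq_smooth_on _ _ _ _ g _ oW).
  by move=> p _; rewrite !lfunE.
rewrite /g /sum_map_fun -[l]fintype.splitK; case: (fintype.split l) => k /=.
  apply: (@eq_smooth_on _ _ _ _
    (fun p => tmap j.1 p (tinv i.1 p (lsubmx v)) 0 k) _ oW).
    by move=> p _; rewrite row_mxEl.
  by apply: smooth_onS (triv_smooth i.1 j.1 _ _) => p [[? _] [? _]].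
apply: (@eq_smooth_on _ _ _ _
  (fun p => tmap j.2 p (tinv i.2 p (rsubmx v)) 0 k) _ oW).
  by move=> p _; rewrite row_mxEr.
by apply: smooth_onS (triv_smooth i.2 j.2 _ _) => p [[_ ?] [_ ?]].
Qed.

Definition whitney_sum : vbundle M :=
  @VBundle R n M (fun p => (E p * F p)%type) (rank E + rank F) T D sum_map
    sum_inv (fun p => (triv_at p, triv_at p)) sum_atP sum_open sum_mapK sum_invK
    sum_smooth.

End Whitney.

Record section E := Section_ {
  sec :> forall p, E p;
  sec_smooth : forall i l, smooth_on (tdom i) (fun p => tmap i p (sec p) 0 l)
}.

Record bundle_map E F := BundleMap {
  bmap :> forall p, 'Hom(E p, F p);
  bmap_smooth : forall i j v l,
    smooth_on (tdom i `&` tdom j)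
      (fun p => tmap j p (bmap p (tinv i p v)) 0 l)
}.

Lemma sectionP E (s t : section E) : (forall p, s p = t p) -> s = t.
Proof.
case: s t => [s hs] [t ht] /= st; have {}st : s = t.
  exact: functional_extensionality_dep.
by case: _ / st ht => ht; congr Section_; exact: Prop_irrelevance.
Qed.

Section SectionModule.
Variable E : vbundle M.
Implicit Types (s t : section E) (f : smooth_fun M).

HB.instance Definition _ := gen_eqMixin (section E).
HB.instance Definition _ := gen_choiceMixin (section E).

Lemma zero_smooth (i : triv E) l :
  smooth_on (tdom i) (fun p => tmap i p 0 0 l).
Proof.
apply: (@eq_smooth_on _ _ _ _ (cst 0)); first exact: tdom_open.
  by move=> p _; rewrite linear0 mxE.
exact: smooth_on_cst.
Qed.
Definition zero_sec : section E := Section_ zero_smooth.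

Lemma add_smooth s t (i : triv E) l :
  smooth_on (tdom i) (fun p => tmap i p (s p + t p) 0 l).
Proof.
have oW := tdom_open i.
apply: (@eq_smooth_on _ _ _ _
  ((fun p => tmap i p (s p) 0 l) + (fun p => tmap i p (t p) 0 l))) => //.
  by move=> p _; rewrite linearD mxE.
by apply: smooth_onD => //; exact: sec_smooth.
Qed.
Definition add_sec s t : section E := Section_ (add_smooth s t).

Lemma scale_smooth f s (i : triv E) l :
  smooth_on (tdom i) (fun p => tmap i p (f p *: s p) 0 l).
Proof.
have oW := tdom_open i.
apply: (@eq_smooth_on _ _ _ _ ((f : M -> R) * (fun p => tmap i p (s p) 0 l))).
- by [].
- by move=> p _; rewrite linearZ mxE.
- apply: smooth_onM => //; [exact: smooth_funP|exact: sec_smooth].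
Qed.
Definition scale_sec f s : section E := Section_ (scale_smooth f s).

Definition opp_sec s : section E := scale_sec (-1) s.

Lemma add_secA : associative add_sec.
Proof. by move=> s t u; apply: sectionP => p /=; rewrite addrA. Qed.
Lemma add_secC : commutative add_sec.
Proof. by move=> s t; apply: sectionP => p /=; rewrite addrC. Qed.
Lemma add0sec : left_id zero_sec add_sec.
Proof. by move=> s; apply: sectionP => p /=; rewrite add0r. Qed.
Lemma addNsec : left_inverse zero_sec opp_sec add_sec.
Proof. by move=> s; apply: sectionP => p /=; rewrite scaleN1r addNr. Qed.
HB.instance Definition _ := GRing.isZmodule.Build (section E)
  add_secA add_secC add0sec addNsec.

Lemma scale_secA f g s : scale_sec f (scale_sec g s) = scale_sec (f * g) s.
Proof. by apply: sectionP => p /=; rewrite scalerA. Qed.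
Lemma scale1sec : left_id 1 scale_sec.
Proof. by move=> s; apply: sectionP => p /=; rewrite scale1r. Qed.
Lemma scale_secDr : right_distributive scale_sec +%R.
Proof. by move=> f s t; apply: sectionP => p /=; rewrite scalerDr. Qed.
Lemma scale_secDl s : {morph scale_sec^~ s : f g / f + g}.
Proof. by move=> f g; apply: sectionP => p /=; rewrite scalerDl. Qed.
HB.instance Definition _ := GRing.Zmodule_isLmodule.Build (smooth_fun M)
  (section E) scale_secA scale1sec scale_secDr scale_secDl.

End SectionModule.

Lemma app_smooth E F (a : bundle_map E F) (s : section E) (j : triv F) l :
  smooth_on (tdom j) (fun p => tmap j p (a p (s p)) 0 l).
Proof.
apply: smooth_on_bigcup => p jp; have ip := @triv_atP _ _ _ E p.
set i := triv_at p in ip.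
have oW : open (tdom i `&` tdom j) by apply: openI; exact: tdom_open.
exists (tdom i `&` tdom j); first by [].
apply: (@eq_smooth_on _ _ _ _ (\sum_k ((fun p => tmap i p (s p) 0 k) *
  (fun p => tmap j p (a p (tinv i p 'e_k)) 0 l)))) => //.
  move=> q; rewrite inE => -[iq jq]; rewrite fct_sumE -[in RHS](tmapK iq (s q)).
  rewrite [in RHS](row_sum_delta (tmap i q (s q))) !linear_sum summxE.
  by apply: eq_bigr => k _; rewrite !linearZ mxE.
apply: smooth_on_sum => // k; apply: smooth_onM => //.
  by apply: smooth_onS (sec_smooth s i k) => q [].
exact: bmap_smooth.
Qed.
Definition bmap_sec E F (a : bundle_map E F) (s : section E) : section F :=
  Section_ (app_smooth a s).

Lemma fst_smooth E F (e : section (whitney_sum E F)) i l :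
  smooth_on (tdom i) (fun p => tmap i p (e p).1 0 l).
Proof.
apply: smooth_on_bigcup => p ip; have jp := @triv_atP _ _ _ F p.
set j := triv_at p in jp.
have oW : open (tdom i `&` tdom j) by apply: openI; exact: tdom_open.
exists (tdom i `&` tdom j); first by [].
apply: (eq_smooth_on oW _ (sec_smooth e (i, j) (lshift _ l))) => q _.
by rewrite /= lfunE /= row_mxEl.
Qed.
Definition sec_fst E F (e : section (whitney_sum E F)) : section E :=
  Section_ (fst_smooth e).

Lemma snd_smooth E F (e : section (whitney_sum E F)) j l :
  smooth_on (tdom j) (fun p => tmap j p (e p).2 0 l).
Proof.
apply: smooth_on_bigcup => p jp; have ip := @triv_atP _ _ _ E p.
set i := triv_at p in ip.
have oW : open (tdom i `&` tdom j) by apply: openI; exact: tdom_open.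
exists (tdom i `&` tdom j); first by [].
apply: (eq_smooth_on oW _ (sec_smooth e (i, j) (rshift _ l))) => q _.
by rewrite /= lfunE /= row_mxEr.
Qed.
Definition sec_snd E F (e : section (whitney_sum E F)) : section F :=
  Section_ (snd_smooth e).

Lemma pair_smooth E F (s : section E) (t : section F)
    (i : triv (whitney_sum E F)) l :
  smooth_on (tdom i) (fun p => tmap i p ((s p, t p) : whitney_sum E F p) 0 l).
Proof.
have oW := tdom_open i; pose g p := sum_map_fun i (s p, t p) 0 l.
apply: (@eq_smooth_on _ _ _ _ g _ oW).
  by move=> p _; rewrite lfunE.
rewrite /g /sum_map_fun -[l]fintype.splitK; case: (fintype.split l) => k /=.
  apply: (@eq_smooth_on _ _ _ _ (fun p => tmap i.1 p (s p) 0 k) _ oW).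
    by move=> p _; rewrite row_mxEl.
  by apply: smooth_onS (sec_smooth s i.1 k) => p [].
apply: (@eq_smooth_on _ _ _ _ (fun p => tmap i.2 p (t p) 0 k) _ oW).
  by move=> p _; rewrite row_mxEr.
by apply: smooth_onS (sec_smooth t i.2 k) => p [].
Qed.
(* The section written s + t in the direct sum. *)
Definition sec_pair E F (s : section E) (t : section F) :
  section (whitney_sum E F) := Section_ (pair_smooth s t).

Lemma pairing_smooth E (xi : section (dual_bundle E)) (y : section E) :
  smooth_on setT (fun p => xi p (y p) : R).
Proof.
apply: smooth_on_bigcup => p _; have ip := @triv_atP _ _ _ E p.
set i := triv_at p in ip; have oW := tdom_open i.
exists (tdom i) => //.
apply: (@eq_smooth_on _ _ _ _ (\sum_k ((fun p => dual_map i p (xi p) 0 k) *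
  (fun p => tmap i p (y p) 0 k)))) => //.
  move=> q; rewrite inE => iq; rewrite fct_sumE.
  by rewrite -[in RHS](dual_mapK iq (xi q)) dual_invE.
apply: smooth_on_sum => // k; apply: smooth_onM => //.
  exact: (sec_smooth xi).
exact: sec_smooth.
Qed.
Definition pairing E (xi : section (dual_bundle E)) (y : section E) :
  smooth_fun M := mk_smooth (pairing_smooth xi y).

Lemma vf_app_smooth (X : section (tangent_bundle M)) (f : smooth_fun M) :
  smooth_on setT
    (fun p => 'D_(X p) (f \o coordV (chart_at p)) (coord (chart_at p) p)).
Proof.
apply: smooth_on_bigcup => p _; have cp := chart_atP p.
set c := chart_at p in cp; have oW := dom_open c.
exists (dom c) => //.
have sf : smooth_in (coord c @` dom c) (f \o coordV c).
  by have := @smooth_funP _ _ _ f setT c; rewrite setIT.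
apply: (@eq_smooth_on _ _ _ _ (\sum_k ((fun q => tangent_map c q (X q) 0 k) *
  ('D_('e_k) (f \o coordV c) \o coord c)))) => //.
  move=> q; rewrite inE => cq; rewrite fct_sumE.
  have df : differentiable (f \o coordV c) (coord c q).
    by apply: (smooth_in_diff sf); exists q.
  rewrite (jac_comp _ (chart_atP q) cq df) [RHS]deriveE //.
  rewrite [in RHS](row_sum_delta (X q *m jac _ _ _)) linear_sum.
  by apply: eq_bigr => k _; rewrite linearZ !fctE /tangent_map lfunE /= deriveE.
apply: smooth_on_sum => // k; apply: smooth_onM => //.
  exact: (sec_smooth X).
by apply: smooth_on_coord => //; exact: smooth_in_derive.
Qed.

(* The derivative X(f) of the function f along the vector field X. *)
Definition vf_app (X : section (tangent_bundle M)) (f : smooth_fun M) :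
  smooth_fun M := mk_smooth (vf_app_smooth X f).

(* The section zeta of the dual bundle with <zeta, y> = F y for all y; there is
   exactly one as soon as F is C^oo(M)-linear, and the value is 0 by convention
   when there is none. *)
Definition dual_section E (F : section E -> smooth_fun M) :
    section (dual_bundle E) :=
  xget 0 [set zeta | forall y, pairing zeta y = F y].

End Bundle.

Record left_symmetric_algebroid (R : realType) (n : nat) (M : manifold R n) :=
  LeftSymmetricAlgebroid {
  lsa_bundle :> vbundle M;
  lsa_mul : section lsa_bundle -> section lsa_bundle -> section lsa_bundle;
  lsa_anchor : bundle_map lsa_bundle (tangent_bundle M);
  lsa_mulDl : forall x y z, lsa_mul (x + y) z = lsa_mul x z + lsa_mul y z;
  lsa_mulDr : forall x y z, lsa_mul x (y + z) = lsa_mul x y + lsa_mul x z;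
  lsa_mul_cstl : forall a x y,
    lsa_mul (smooth_cst a *: x) y = smooth_cst a *: lsa_mul x y;
  lsa_mul_cstr : forall a x y,
    lsa_mul x (smooth_cst a *: y) = smooth_cst a *: lsa_mul x y;
  lsa_left_symmetric : forall x y z,
    lsa_mul x (lsa_mul y z) - lsa_mul (lsa_mul x y) z =
    lsa_mul y (lsa_mul x z) - lsa_mul (lsa_mul y x) z;
  lsa_leibniz : forall x f y,
    lsa_mul x (f *: y) =
    f *: lsa_mul x y + vf_app (bmap_sec lsa_anchor x) f *: y;
  lsa_mulZl : forall f x y, lsa_mul (f *: x) y = f *: lsa_mul x y
}.
Arguments lsa_mul {R n M l} x y.
Arguments lsa_anchor {R n M} l.

Section LeftSymmetric.
Context {R : realType} {n : nat} {M : manifold R n}.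
Context {A : left_symmetric_algebroid M}.
Implicit Types (x y : section A) (xi eta : section (dual_bundle A)).
Implicit Types (f : smooth_fun M).

(* a_A(x)(f) *)
Definition anchor_app x f : smooth_fun M := vf_app (bmap_sec (lsa_anchor A) x) f.

Definition lsa_bracket x y : section A := lsa_mul x y - lsa_mul y x.

Definition Lstar x xi : section (dual_bundle A) := dual_section (fun y =>
  anchor_app x (pairing xi y) - pairing xi (lsa_mul x y)).

(* The Lie derivative of xi along x in the sub-adjacent Lie algebroid. *)
Definition lie_derivative x xi : section (dual_bundle A) := dual_section (fun y =>
  anchor_app x (pairing xi y) - pairing xi (lsa_bracket x y)).

Definition Rstar x xi : section (dual_bundle A) := dual_section (fun y =>
  - pairing xi (lsa_mul y x)).

Definition lsa_d f : section (dual_bundle A) := dual_section (fun x =>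
  anchor_app x f).

End LeftSymmetric.

Section PhaseSpace.
Context {R : realType} {n : nat} {M : manifold R n}.
Context {A : left_symmetric_algebroid M}.

Definition phase_bundle : vbundle M := whitney_sum A (dual_bundle A).

Implicit Types (e : section phase_bundle).

Definition phase_bracket e1 e2 : section phase_bundle :=
  let x := sec_fst e1 in let xi := sec_snd e1 in
  let y := sec_fst e2 in let eta := sec_snd e2 in
  sec_pair (lsa_bracket x y) (Lstar x eta - Lstar y xi).

(* rho(e)(f) *)
Definition phase_anchor_app e (f : smooth_fun M) : smooth_fun M :=
  anchor_app (sec_fst e) f.

Definition phase_omega e1 e2 : smooth_fun M :=
  pairing (sec_snd e1) (sec_fst e2) - pairing (sec_snd e2) (sec_fst e1).

Definition pairing_plus e1 e2 : smooth_fun M :=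
  pairing (sec_snd e1) (sec_fst e2) + pairing (sec_snd e2) (sec_fst e1).

Definition is_presymplectic_mul
    (star : section phase_bundle -> section phase_bundle -> section phase_bundle) :=
  forall e1 e2 e3,
    phase_omega (star e1 e2) e3 =
    phase_anchor_app e1 (phase_omega e2 e3)
    + smooth_cst 2^-1 * phase_anchor_app e3 (phase_omega e1 e2)
    - phase_omega e2 (phase_bracket e1 e3).

End PhaseSpace.
Arguments phase_bundle {R n M} A.
Arguments is_presymplectic_mul {R n M} A star.

(* Main.v *)
From HB Require Import structures.
From mathcomp Require Import all_boot all_order all_algebra.
From mathcomp Require Import boolp classical_sets functions reals topology.
From mathcomp Require Import normedtype derive sequences exp realfun.
From mathcomp Require Import ring lra.
Require Import Defs.

(** The form omega is nondegenerate on sections, so the defining identity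
    admits at most one solution; hence it is enough to exhibit one.  The
    formula with the Lie derivative, [Rstar] and the differential is one: after
    each dual section in it is replaced by the function that defines it, both
    sides of the identity become combinations of the same terms and agree
    because half of a_A(z)<xi,y> added to itself is a_A(z)<xi,y>
    ([phase_mul_presymplectic]).

    The geometric content is in two facts that this argument takes for granted.

    First, L^*_x xi, the Lie derivative, R^*_x xi and df are specified by their
    pairings with all sections, and such a dual section exists because each of
    the prescribed functionals is linear over smooth functions: whenever the
    Leibniz rules produce derivative terms, these cancel.  A functional F
    linear over smooth functions is represented by a dual section
    ([exists_dual_section]) because F(y) at p depends only on y(p)
    ([tensorial_eq]).  That in turn follows by writing b^2 y = sum_k c_k e_k, where b is a bump function at p
    supported in a trivializing open set, e_k is b times the local frame and
    c_k is b times the k-th coordinate of y ([local_frame]).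

    Secondly, omega is nondegenerate on global sections
    ([phase_omega_inj]) because every vector, and every covector, at a point is
    the value of a global section ([section_through]); this again uses
    [local_frame].

    Both facts therefore rest on the existence of smooth bump functions on the
    manifold ([exists_bump]).  They are built in a chart from exp(-1/t), and
    extending them by zero is legitimate because a compact subset of a
    Hausdorff space is closed. *)

Set Implicit Arguments.
Unset Strict Implicit.
Unset Printing Implicit Defensive.

Import Order.TTheory GRing.Theory Num.Theory numFieldNormedType.Exports.

Local Open Scope classical_set_scope.
Local Open Scope ring_scope.

(** * The flat function exp(-1/t) *)

Section Flat.
Context {R : realType}.
Implicit Types (m : nat) (t : R).

(** The powers of 1/t are carried along so that the family is closed, up to
    linear combinations, under differentiation. *)
Definition flat m t : R :=
  if 0 < t then t^-1 ^+ m * expR (- t^-1) else 0.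

Lemma flat_le0 m t : t <= 0 -> flat m t = 0.
Proof. by rewrite /flat leNgt => /negbTE ->. Qed.

Lemma flat_gt0 m t : 0 < t -> 0 < flat m t.
Proof. by move=> t0; rewrite /flat t0 mulr_gt0 ?expR_gt0 // exprn_gt0 ?invr_gt0. Qed.

Lemma flat_ge0 m t : 0 <= flat m t.
Proof. by case: (ltP 0 t) => [/(flat_gt0 m)/ltW//|/flat_le0 ->]. Qed.

Lemma flat0_le : {homo flat 0 : s t / s <= t}.
Proof.
move=> s t st; case: (ltP 0 s) => [s0|/flat_le0 ->]; last exact: flat_ge0.
have t0 := lt_le_trans s0 st; rewrite /flat s0 t0 !expr0 !mul1r ler_expR.
by rewrite lerN2 lef_pV2.
Qed.

(** A quadratic bound at 0 is all that the derivative there requires; it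
    comes from the term of degree m + 2 of the exponential series at 1/t. *)
Lemma flat_le_sqr m t : flat m t <= (m.+2)`!%:R * t ^+ 2.
Proof.
case: (ltP 0 t) => [t0|/(flat_le0 m) ->]; last by rewrite mulr_ge0 // sqr_ge0.
have u0 : 0 < t^-1 by rewrite invr_gt0.
rewrite /flat t0 expRN ler_pdivrMr ?expR_gt0 //.
have := expR_ge1Dxn m.+1 (ltW u0); set N := _`!%:R.
have N0 : 0 < N :> R by rewrite ltr0n fact_gt0.
have /le_trans H1 : t^-1 ^+ m.+2 / N <= 1 + t^-1 ^+ m.+2 / N by rewrite lerDr.
move=> /H1; rewrite ler_pdivrMr // => H.
have -> : t^-1 ^+ m = t ^+ 2 * t^-1 ^+ m.+2.
  by rewrite -[m.+2]addn2 exprD mulrCA -exprMn divff ?gt_eqF // expr1n mulr1.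
have -> : N * t ^+ 2 * expR t^-1 = t ^+ 2 * (expR t^-1 * N) by ring.
by rewrite ler_pM2l // exprn_gt0.
Qed.

(** The formula is the product rule for t > 0; at 0 it says that the derivative
    vanishes, by [flat_le_sqr]. *)
Lemma is_derive_flat m t :
  is_derive t 1 (flat m) (flat m.+2 t - m%:R * flat m.+1 t).
Proof.
have [t0|t0|->] := ltgtP t 0.
- rewrite !(flat_le0 _ (ltW t0)) mulr0 subr0.
  apply: (@near_eq_is_derive _ _ _ (cst 0)) => //.
  near=> y; rewrite flat_le0 //; apply/ltW; near: y; exact: lt_nbhsl.
- pose g (y : R) := (y^-1) ^+ m * expR (- y^-1).
  apply: (@near_eq_is_derive _ _ _ g).
    near=> y; rewrite /flat ifT //; near: y; exact: lt_nbhsr.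
  have tN0 : t != 0 by rewrite gt_eqF.
  have dV : is_derive t 1 (fun y : R => y^-1) (- t ^- 2 *: 1).
    exact: (@is_deriveV _ id).
  have dE : is_derive t 1 (expR \o (- (fun y : R => y^-1))) _ :=
    is_derive1_comp (is_derive_expR _) (is_deriveN dV).
  have := is_deriveM (is_deriveX m dV) dE.
  rewrite (_ : _ * _ = g); last by apply/funext => y; rewrite !fctE.
  move=> dg; apply: (is_derive_eq dg).
  rewrite /flat t0 !fctE /GRing.scale /= !mulr1 opprK -exprVn.
  case: m {g dg} => [|m] /=; rewrite !exprS; ring.
- rewrite !flat_le0 // mulr0 subr0.
  have H : h^-1 *: ((flat m \o shift 0) (h *: (1 : R)) - flat m 0) @[h --> 0^'] --> (0 : R).
    apply/cvgr0Pnorm_le => e e0 /=.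
    pose C : R := (m.+2)`!%:R.
    have C0 : 0 < C by rewrite ltr0n fact_gt0.
    near=> h.
    have h0 : h != 0 by near: h; exact: nbhs_dnbhs_neq.
    have he : `|h| <= e / C.
      by near: h; apply: dnbhs0_le; rewrite divr_gt0.
    rewrite [flat m 0]flat_le0 // subr0 addr0 /GRing.scale /= mulr1 normrM normfV.
    rewrite ler_pdivrMl ?normr_gt0 // ger0_norm ?flat_ge0 //.
    apply: le_trans (flat_le_sqr m h) _; rewrite -/C -normr_id.
    rewrite -[h ^+ 2]ger0_norm ?sqr_ge0 // normrX expr2 mulrCA normr_id.
    by rewrite ler_pM2l ?normr_gt0 // mulrC -ler_pdivlMr.
  by apply: DeriveDef; [exact: cvgP H|exact: cvg_lim H].
Unshelve. all: by end_near. Qed.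

End Flat.

(** * Smooth functions on R^n *)

Section SmoothFlat.
Context {R : realType} {n : nat}.
Implicit Types (U : set 'rV[R]_n) (f g : 'rV[R]_n -> R).

Lemma derive_flat_comp m f x v : differentiable f x ->
  differentiable (flat m \o f) x /\
  'D_v (flat m \o f) x = (flat m.+2 (f x) - m%:R * flat m.+1 (f x)) * 'D_v f x.
Proof.
move=> df; have [dm Dm] := is_derive_flat m (f x).
have {}dm : differentiable (flat m) (f x) by apply/derivable1_diffP.
have dc : differentiable (flat m \o f) x by exact: differentiable_comp.
split=> //; rewrite deriveE // diff_comp //= diff1E //= derive1E Dm.
by rewrite [in RHS]deriveE // [RHS]mulrC.
Qed.

(** By induction on the order of differentiation, for all the exponents m at
    once: a derivative of the composite involves only other members of the
    family. *)
Lemma diffn_on_flat k m U f : open U -> diffn_on k U f ->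
  diffn_on k U (flat m \o f).
Proof.
move=> oU; elim: k m f => [//|k IH] m f sf; have [df sdf] := sf.
split=> [x /df dfx|i]; first by have [] := derive_flat_comp m 0 dfx.
apply: (@eq_diffn_on _ _ _ _
  (((flat m.+2 \o f) + cst (- m%:R) * (flat m.+1 \o f)) * 'D_('e_i) f)) => //.
  move=> x; rewrite inE => /df dfx.
  by have [_ ->] := derive_flat_comp m 'e_i dfx; rewrite !fctE mulNr.
have fW := diffn_onW sf.
apply: diffn_onM => //; last exact: sdf.
apply: diffn_onD => //; first exact: IH.
by apply: diffn_onM => //; [exact: (@smooth_in_cst _ _ _ _ k)|exact: IH].
Qed.

Lemma smooth_in_flat m U f : open U -> smooth_in U f -> smooth_in U (flat m \o f).
Proof. by move=> oU sf k; exact: diffn_on_flat. Qed.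

Lemma smooth_in_proj U j : smooth_in U (fun x : 'rV[R]_n => x 0 j).
Proof.
have dj (x : 'rV[R]_n) : differentiable (fun x : 'rV[R]_n => x 0 j) x.
  exact: differentiable_coord.
case=> [//|k]; split=> // i.
rewrite (_ : 'D_('e_i) _ = (cst (i == j)%:R : 'rV[R]_n -> R)).
  exact: smooth_in_cst.
apply/funext => x.
have := @derive_mx R _ _ _ id x 'e_i (@derivable_id _ _ _ _).
by rewrite derive_id => /matrixP/(_ 0 j); rewrite !mxE eqxx /= eq_sym => <-.
Qed.

(** Two applications of the flat function give a plateau: with u the squared
    Euclidean distance to x0 in units of r^2 and h = [flat 0], the function
    h (h 1 - h (2 u - 1)) is constant and positive for u <= 1/2, and it vanishes
    for u >= 1. *)
Lemma exists_bump_rV (x0 : 'rV[R]_n) (r : R) : 0 < r ->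
  exists phi : 'rV[R]_n -> R, [/\ forall U, open U -> smooth_in U phi,
    forall x, r <= `|x - x0| -> phi x = 0 & \forall x \near x0, phi x = 1].
Proof.
move=> r0; pose s := \sum_j (fun x : 'rV[R]_n => (x 0 j - x0 0 j) ^+ 2).
pose a x := 2 * (s x / r ^+ 2) - 1.
pose psi := flat 0 \o (fun x => flat 0 1 - flat 0 (a x)) : 'rV[R]_n -> R.
have sS U : open U -> smooth_in U s.
  move=> oU; apply: smooth_in_sum => // j.
  have sj : smooth_in U ((fun x : 'rV[R]_n => x 0 j) + cst (- x0 0 j)).
    by apply: smooth_inD => //; [exact: smooth_in_proj|exact: smooth_in_cst].
  exact: (smooth_inM oU sj sj).
have sA U : open U -> smooth_in U a.
  move=> oU; rewrite (_ : a = (cst (2 / r ^+ 2)) * s + cst (- 1)).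
    apply: smooth_inD => //; last exact: smooth_in_cst.
    by apply: smooth_inM => //; [exact: smooth_in_cst|exact: sS].
  by apply/funext => x; rewrite /a !fctE mulrCA mulrC.
have sP U : open U -> smooth_in U psi.
  move=> oU; apply: smooth_in_flat => //.
  rewrite (_ : (fun _ => _) = cst (flat 0 1) + cst (-1) * (flat 0 \o a)); last first.
    by apply/funext => x; rewrite !fctE /= mulN1r.
  apply: smooth_inD => //; first exact: smooth_in_cst.
  apply: smooth_inM => //; first exact: smooth_in_cst.
  by apply: smooth_in_flat => //; exact: sA.
pose C : R := flat 0 (flat 0 1).
have C0 : C != 0 by rewrite gt_eqF // !flat_gt0.
exists (cst C^-1 * psi); split.
- by move=> U oU; apply: smooth_inM => //; [exact: smooth_in_cst|exact: sP].
- move=> x rx; rewrite !fctE [psi x]flat_le0 ?mulr0 // subr_le0; apply: flat0_le.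
  have rs : r ^+ 2 <= s x.
    (* The norm is the sup norm, attained at some coordinate j, so that the
       Euclidean square s dominates its square. *)
    have [[i j]] := mx_norm_neq0 (lt0r_neq0 (lt_le_trans r0 rx)).
    rewrite /= (ord1 i) => xj; move: (rx).
    rewrite (_ : `|x - x0| = `|x 0 j - x0 0 j|); last by rewrite [LHS]xj !mxE.
    move=> {}rx.
    rewrite /s fct_sumE (bigD1 j) //=; apply: ler_wpDr.
      by apply: sumr_ge0 => k _; exact: sqr_ge0.
    by rewrite -[leRHS]real_normK ?num_real // ler_sqr ?nnegrE // ltW.
  rewrite /a; have : 1 <= s x / r ^+ 2 by rewrite ler_pdivlMr ?mul1r ?exprn_gt0.
  by move=> ?; lra.
- have a0 : a x0 = -1.
    rewrite /a /s fct_sumE big1 ?mul0r ?mulr0 ?sub0r // => j _.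
    by rewrite subrr expr0n.
  have ca : {for x0, continuous a}.
    exact/differentiable_continuous/(smooth_in_diff (sA _ openT)).
  have : \forall x \near x0, a x < 0.
    by apply: (cvgr_lt _ ca); rewrite a0 ltrN10.
  apply: filterS => x /ltW ax; rewrite !fctE /psi /= (flat_le0 0 ax) subr0.
  by rewrite mulVf.
Qed.
End SmoothFlat.

(** * Bump functions on a manifold *)

Section Bump.
Context {R : realType} {n : nat} {M : manifold R n}.
Implicit Types (p : M) (W K D : set M) (f g : M -> R).

(** D is covered by the open sets W and the complement of K; on the second one f
    is zero. *)
Lemma smooth_on_glue D W K f : open D -> closed K -> K `<=` W ->
  smooth_on (W `&` D) f -> (forall q, ~ K q -> f q = 0) -> smooth_on D f.
Proof.
move=> oD cK KW sf f0; apply: smooth_on_bigcup => q Dq.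
have [Kq|nKq] := pselect (K q); first by exists (W `&` D) => //; split=> //; exact: KW.
exists (~` K) => //; apply: (@eq_smooth_on _ _ _ _ (cst 0)).
- exact: closed_openC.
- by move=> x; rewrite inE => /f0.
- exact: smooth_on_cst.
Qed.

(** The bump function of R^n transported by a chart and extended by zero.  The
    set K is the image of a closed ball, which is compact and hence, the
    manifold being Hausdorff, closed. *)
Lemma exists_bump p W : open W -> W p ->
  exists (b : smooth_fun M) (K : set M), [/\ closed K, K `<=` W,
    forall q, ~ K q -> b q = 0 & \forall q \near p, b q = 1].
Proof.
move=> oW Wp; have cp := chart_atP p; set c := chart_at p in cp.
have /nbhs_ballP [e /= e0 eO] : nbhs (coord c p) (coord c @` (dom c `&` W)).
  by apply: open_nbhs_nbhs; split; [exact: image_open|exists p].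
pose r := e / 2; have r0 : 0 < r by rewrite divr_gt0.
pose B := [set x : 'rV[R]_n | `|x - coord c p| <= r].
have BO : B `<=` coord c @` (dom c `&` W).
  move=> x xB; apply: eO; rewrite -ball_normE /= distrC.
  apply: le_lt_trans xB _; rewrite /r; lra.
have cB : compact B.
  apply: bounded_closed_compact.
    exists (r + `|coord c p|); split; first exact: num_real.
    move=> y ry x xB; apply/ltW; apply: le_lt_trans ry.
    by rewrite -[x in leLHS](subrK (coord c p)) (le_trans (ler_normD _ _)) // lerD2r.
  rewrite (_ : B = closed_ball (coord c p) r); first exact: closed_ball_closed.
  by rewrite closed_ballE //; apply/seteqP; split=> x; rewrite /B /closed_ball_ /= distrC.
pose K := coordV c @` B.
have cK : closed K.
  apply: compact_closed; first exact: manifold_hausdorff.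
  apply: continuous_compact => //; apply: continuous_in_subspaceT => x.
  by rewrite inE => /BO[q [cq _] <-]; exact: coordV_cts.
have KW : K `<=` dom c `&` W.
  by move=> _ [x /BO[q [cq Wq] <-] <-]; rewrite coordK.
have [phi [sphi phi0 phi1]] := exists_bump_rV (coord c p) r0.
pose b q := if `[< (dom c `&` W) q >] then phi (coord c q) else 0.
have bE q : (dom c `&` W) q -> b q = phi (coord c q) by move=> Wq; rewrite /b asboolT.
have ocW : open (dom c `&` W) by apply: openI => //; exact: dom_open.
have b0 q : ~ K q -> b q = 0.
  move=> nKq; rewrite /b; case: asboolP => // -[cq _]; apply: phi0.
  rewrite leNgt; apply/negP => /ltW qB; apply: nKq; exists (coord c q) => //.
  by rewrite coordK.
have sb : smooth_on setT b.
  apply: (smooth_on_glue openT cK KW) => //; rewrite setIT.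
  apply: (@eq_smooth_on _ _ _ _ (phi \o coord c)) => //.
    by move=> q; rewrite inE => /bE ->.
  apply: smooth_on_coord => //; apply: sphi; exact: image_open.
exists (mk_smooth sb), K; split => //; first by move=> q /KW[].
have Wn : \forall q \near p, (dom c `&` W) q by apply: open_nbhs_nbhs.
have := coord_cts cp phi1; apply: filterS2 Wn => q Wq /= H.
by rewrite bE.
Qed.

End Bump.

(** * Global sections of vector bundles *)

Section Tensorial.
Context {R : realType} {n : nat} {M : manifold R n}.
Implicit Types (E : vbundle M) (p : M).

Lemma smooth_fun_ext (f g : smooth_fun M) : (forall p, f p = g p) -> f = g.
Proof. by move=> fg; apply: val_inj; apply/funext. Qed.

Lemma smooth_fun_sumE (I : Type) (s : seq I) (F : I -> smooth_fun M) p :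
  (\sum_(i <- s) F i) p = \sum_(i <- s) F i p.
Proof. by elim/big_rec2 : _ => // i x y _ <-. Qed.

Lemma section_sumE E (I : Type) (s : seq I) (F : I -> section E) p :
  (\sum_(i <- s) F i) p = \sum_(i <- s) F i p.
Proof. by elim/big_rec2 : _ => // i x y _ <-. Qed.

(** The sections e_k are b times the local frame, extended by zero, and c_k is b
    times the k-th coordinate of y; both factors have to be cut off to be
    global, whence the square of b. *)
Lemma local_frame E (i : triv E) p : tdom i p ->
  exists (b : smooth_fun M) (e : 'I_(rank E) -> section E),
   [/\ b p = 1, \forall q \near p, forall k, e k q = tinv i q 'e_k &
     forall y : section E, exists c : 'I_(rank E) -> smooth_fun M,
       (forall k, c k p = tmap i p (y p) 0 k) /\
       (b * b) *: y = \sum_k c k *: e k].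
Proof.
move=> ip; have [b [K [cK KW b0 b1]]] := exists_bump (@tdom_open _ _ _ E i) ip.
have bp : b p = 1 := nbhs_singleton b1.
have se k (j : triv E) l :
    smooth_on (tdom j) (fun q => tmap j q (b q *: tinv i q 'e_k) 0 l).
  apply: (smooth_on_glue (tdom_open j) cK KW) => [|q /b0 ->].
    have oW : open (tdom i `&` tdom j) by apply: openI; exact: tdom_open.
    apply: (@eq_smooth_on _ _ _ _
      ((b : M -> R) * (fun q => tmap j q (tinv i q 'e_k) 0 l))) => //.
      by move=> q _; rewrite linearZ mxE.
    by apply: smooth_onM => //; [exact: smooth_funP|exact: triv_smooth].
  by rewrite scale0r linear0 mxE.
have sc (y : section E) k : smooth_on setT (fun q => b q * tmap i q (y q) 0 k).
  apply: (smooth_on_glue openT cK KW) => [|q /b0 ->]; last by rewrite mul0r.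
  rewrite setIT; apply: smooth_onM; first exact: tdom_open.
    exact: smooth_funP.
  exact: sec_smooth.
exists b, (fun k => Section_ (se k)); split=> //.
  by apply: filterS b1 => q bq k /=; rewrite bq scale1r.
move=> y; exists (fun k => mk_smooth (sc y k)); split=> [k|].
  by rewrite /= bp mul1r.
apply: sectionP => q; rewrite section_sumE /=.
transitivity ((b q * b q) *: y q) => //.
have [Kq|/b0 bq] := pselect (K q); last first.
  by rewrite big1 => [|k _]; rewrite bq ?mul0r scale0r.
rewrite -[in LHS](tmapK (KW _ Kq) (y q)) [in LHS](row_sum_delta (tmap i q (y q))).
rewrite linear_sum scaler_sumr; apply: eq_bigr => k _.
by rewrite linearZ !scalerA mulrAC.
Qed.

Lemma section_through E p (v : E p) : exists s : section E, s p = v.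
Proof.
have ip := @triv_atP _ _ _ E p; have [b [e [_ eE _]]] := local_frame ip.
exists (\sum_k smooth_cst (tmap (triv_at p) p v 0 k) *: e k).
rewrite section_sumE -[RHS](tmapK ip) [in RHS](row_sum_delta (tmap _ p v)) linear_sum.
by apply: eq_bigr => k _; rewrite linearZ /= (nbhs_singleton eE).
Qed.

Definition tensorial E (F : section E -> smooth_fun M) :=
  (forall y z, F (y + z) = F y + F z) /\ (forall f y, F (f *: y) = f * F y).

(** F(y) at p equals F(b^2 y) at p, a combination of the F(e_k) at p whose
    coefficients are the coordinates of y(p). *)
Lemma tensorial_eq0 E (F : section E -> smooth_fun M) (y : section E) p :
  tensorial F -> y p = 0 -> F y p = 0.
Proof.
move=> [FD FZ] y0; have ip := @triv_atP _ _ _ E p.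
have [b [e [b1 _ /(_ y)[c [cE yE]]]]] := local_frame ip.
have F0 : F 0 = 0 by rewrite -(scale0r 0) FZ mul0r.
have -> : F y p = ((b * b) * F y) p.
  by transitivity (b p * b p * F y p); rewrite // b1 !mul1r.
rewrite -FZ yE (big_morph F FD F0) smooth_fun_sumE big1 // => k _.
rewrite FZ; transitivity (c k p * F (e k) p) => //.
by rewrite cE y0 linear0 mxE mul0r.
Qed.

Lemma tensorial_eq E (F : section E -> smooth_fun M) (y z : section E) p :
  tensorial F -> y p = z p -> F y p = F z p.
Proof.
move=> FT yz; apply/eqP; rewrite -subr_eq0; apply/eqP.
have <- : F (y - z) p = 0.
  by apply: tensorial_eq0 => //=; rewrite yz scaleN1r subrr.
have [FD FZ] := FT.
by rewrite FD -[- z]scaleN1r FZ mulN1r.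
Qed.

(** The covector at p sends v to F(s) at p for any section s through v; this is
    independent of s by [tensorial_eq].  Near p its k-th coordinate is F(e_k)
    for the extended frame of [local_frame], which shows smoothness. *)
Lemma exists_dual_section E (F : section E -> smooth_fun M) : tensorial F ->
  exists zeta : section (dual_bundle E), forall y, pairing zeta y = F y.
Proof.
move=> FT; have [FD FZ] := FT.
pose ext p (v : E p) := sval (cid (section_through v)).
have extE p (v : E p) : ext p v p = v by rewrite /ext; case: cid.
pose z p (v : E p) : R^o := F (ext p v) p.
have zE p (y : section E) : z p (y p) = F y p by apply: tensorial_eq.
have zl p : linear (z p).
  move=> a u v; rewrite /z.
  rewrite (@tensorial_eq _ _ _ (smooth_cst a *: ext p u + ext p v)) //; last first.
    by rewrite /= !extE.
  by rewrite FD FZ.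
have [zh zhE] : exists zh : forall p, 'Hom(E p, R^o), forall p v, zh p v = z p v.
  pose zL p : {linear E p -> R^o} :=
    HB.pack (z p) (GRing.isLinear.Build R (E p) R^o _ (z p) (zl p)).
  by exists (fun p => linfun (zL p)) => p v; rewrite lfunE.
have zs (i : triv (dual_bundle E)) l :
    smooth_on (tdom i) (fun p => tmap i p (zh p : dual_bundle E p) 0 l).
  apply: smooth_on_bigcup => p ip.
  have [b [e [_ eE _]]] := local_frame (ip : tdom (i : triv E) p).
  have [V [oV Vp] VE] : exists2 V, open_nbhs p V &
      V `<=` [set q | forall k, e k q = tinv (i : triv E) q 'e_k].
    by move: eE; rewrite {1}/prop_near1 nbhsE.
  exists V => //; apply: (@eq_smooth_on _ _ _ _ (F (e l))) => //.
    move=> q; rewrite inE => /VE/(_ l) eq.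
    by rewrite [RHS]dual_mapE zhE -eq zE.
  exact: smooth_funP.
exists (Section_ zs) => y; apply: smooth_fun_ext => p /=.
by rewrite zhE zE.
Qed.

(** Since the representing section exists, the choice that defines
    [dual_section] never falls back on its default value 0. *)
Lemma dual_sectionE E (F : section E -> smooth_fun M) : tensorial F ->
  forall y, pairing (dual_section F) y = F y.
Proof.
move=> /exists_dual_section[zeta zE] y.
by rewrite (@xgetPex _ 0 [set zeta | forall y, pairing zeta y = F y]) //; exists zeta.
Qed.

Lemma pairing_inj E (zeta eta : section (dual_bundle E)) :
  (forall y, pairing zeta y = pairing eta y) -> zeta = eta.
Proof.
move=> ze; apply: sectionP => p; apply/lfunP => v.
have [y <-] := section_through v.
by have := congr1 (fun f : smooth_fun M => f p) (ze y).
Qed.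

Lemma pairing_injr E (x y : section E) :
  (forall zeta, pairing zeta x = pairing zeta y) -> x = y.
Proof.
move=> xy; apply: sectionP => p; have ip := @triv_atP _ _ _ E p.
apply: (can_inj (tmapK ip)); apply/rowP => k.
have [zeta zE] := @section_through (dual_bundle E) p (dual_inv (triv_at p) p 'e_k).
have := congr1 (fun f : smooth_fun M => f p) (xy zeta) => /=.
rewrite zE !dual_invE (bigD1 k) //= [in RHS](bigD1 k) //= !mxE !eqxx !mul1r.
by rewrite !big1 ?addr0 // => l lk; rewrite mxE (negbTE lk) mul0r.
Qed.

End Tensorial.

(** * Calculus of vector fields and pairings *)

Section VectorFields.
Context {R : realType} {n : nat} {M : manifold R n}.
Implicit Types (X Y : section (tangent_bundle M)) (f g h : smooth_fun M).

Lemma chart_differentiable f p :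
  differentiable (f \o coordV (chart_at p)) (coord (chart_at p) p).
Proof.
have sf := @smooth_funP _ _ _ f setT (chart_at p).
by apply: (smooth_in_diff sf); exists p => //; split=> //; exact: chart_atP.
Qed.

Lemma vf_appD X f g : vf_app X (f + g) = vf_app X f + vf_app X g.
Proof.
apply: smooth_fun_ext => p /=.
have [df dg] := (chart_differentiable f p, chart_differentiable g p).
transitivity ('D_(X p) ((f \o coordV (chart_at p)) + (g \o coordV (chart_at p)))
  (coord (chart_at p) p)) => //.
by rewrite deriveD //; exact: diff_derivable.
Qed.

(** Chart by chart, this is the product rule for directional derivatives. *)
Lemma vf_appM X f g : vf_app X (f * g) = f * vf_app X g + g * vf_app X f.
Proof.
apply: smooth_fun_ext => p /=.
have [df dg] := (chart_differentiable f p, chart_differentiable g p).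
transitivity ('D_(X p) ((f \o coordV (chart_at p)) * (g \o coordV (chart_at p)))
  (coord (chart_at p) p)) => //.
rewrite deriveM /=; [|exact: diff_derivable..].
by rewrite coordK //; exact: chart_atP.
Qed.

Lemma vf_appDl X Y f : vf_app (X + Y) f = vf_app X f + vf_app Y f.
Proof.
apply: smooth_fun_ext => p /=; have df := chart_differentiable f p.
transitivity ('D_(X p) (f \o coordV (chart_at p)) (coord (chart_at p) p) +
  'D_(Y p) (f \o coordV (chart_at p)) (coord (chart_at p) p)) => //.
by rewrite !deriveE // linearD.
Qed.

Lemma vf_appZl h X f : vf_app (h *: X) f = h * vf_app X f.
Proof.
apply: smooth_fun_ext => p /=; have df := chart_differentiable f p.
transitivity (h p * 'D_(X p) (f \o coordV (chart_at p)) (coord (chart_at p) p)) => //.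
by rewrite !deriveE // linearZ.
Qed.

End VectorFields.

Section Pairing.
Context {R : realType} {n : nat} {M : manifold R n} {E F : vbundle M}.
Implicit Types (xi zeta : section (dual_bundle E)) (x y : section E) (f : smooth_fun M).

Lemma pairingDl xi zeta y : pairing (xi + zeta) y = pairing xi y + pairing zeta y.
Proof. by apply: smooth_fun_ext => p /=; rewrite add_lfunE. Qed.

Lemma pairingZl f xi y : pairing (f *: xi) y = f * pairing xi y.
Proof. by apply: smooth_fun_ext => p /=; rewrite scale_lfunE. Qed.

Lemma pairingNl xi y : pairing (- xi) y = - pairing xi y.
Proof. by rewrite -scaleN1r pairingZl mulN1r. Qed.

Lemma pairingDr xi x y : pairing xi (x + y) = pairing xi x + pairing xi y.
Proof. by apply: smooth_fun_ext => p /=; rewrite linearD. Qed.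

Lemma pairingZr xi f y : pairing xi (f *: y) = f * pairing xi y.
Proof. by apply: smooth_fun_ext => p /=; rewrite linearZ. Qed.

Lemma sec_fst_pair (s : section E) (t : section F) : sec_fst (sec_pair s t) = s.
Proof. exact: sectionP. Qed.

Lemma sec_snd_pair (s : section E) (t : section F) : sec_snd (sec_pair s t) = t.
Proof. exact: sectionP. Qed.

Lemma sec_pair_eta (e : section (whitney_sum E F)) :
  sec_pair (sec_fst e) (sec_snd e) = e.
Proof. by apply: sectionP => p /=; case: (e p). Qed.

Lemma bmap_secD (a : bundle_map E F) x y :
  bmap_sec a (x + y) = bmap_sec a x + bmap_sec a y.
Proof. by apply: sectionP => p /=; rewrite linearD. Qed.

Lemma bmap_secZ (a : bundle_map E F) f x : bmap_sec a (f *: x) = f *: bmap_sec a x.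
Proof. by apply: sectionP => p /=; rewrite linearZ. Qed.

End Pairing.

(** * The product on the phase space *)

Section Algebroid.
Context {R : realType} {n : nat} {M : manifold R n}.
Context {A : left_symmetric_algebroid M}.
Implicit Types (x y z : section A) (xi eta zeta : section (dual_bundle A)).
Implicit Types (f g : smooth_fun M).

Lemma anchor_appD x f g : anchor_app x (f + g) = anchor_app x f + anchor_app x g.
Proof. exact: vf_appD. Qed.

Lemma anchor_appM x f g :
  anchor_app x (f * g) = f * anchor_app x g + g * anchor_app x f.
Proof. exact: vf_appM. Qed.

Lemma anchor_app0 x : anchor_app x 0 = 0.
Proof. by apply: (addrI (anchor_app x 0)); rewrite -anchor_appD !addr0. Qed.

Lemma anchor_appN x f : anchor_app x (- f) = - anchor_app x f.
Proof. by apply: (addrI (anchor_app x f)); rewrite -anchor_appD !subrr anchor_app0. Qed.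

(** Linearity over functions: in a_A(x)<xi,fy> - <xi,x.(fy)> the two terms
    a_A(x)(f)<xi,y> cancel. *)
Lemma Lstar_pairing x xi y :
  pairing (Lstar x xi) y = anchor_app x (pairing xi y) - pairing xi (lsa_mul x y).
Proof.
apply: dual_sectionE; split=> [u v|f u].
  by rewrite pairingDr anchor_appD lsa_mulDr pairingDr opprD addrACA.
rewrite pairingZr anchor_appM lsa_leibniz pairingDr !pairingZr mulrBr opprD.
by rewrite addrACA [pairing xi u * _]mulrC subrr addr0.
Qed.

(** Same cancellation as for [Lstar_pairing]: the second product y.x in the
    bracket is linear over functions in y, hence contributes no derivative. *)
Lemma lie_derivative_pairing x xi y : pairing (lie_derivative x xi) y =
  anchor_app x (pairing xi y) - pairing xi (lsa_bracket x y).
Proof.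
apply: dual_sectionE; split=> [u v|f u].
  rewrite pairingDr anchor_appD -addrACA -opprD -pairingDr; congr (_ - pairing _ _).
  by rewrite /lsa_bracket lsa_mulDr lsa_mulDl opprD addrACA.
have -> : lsa_bracket x (f *: u) = f *: lsa_bracket x u + anchor_app x f *: u.
  by rewrite /lsa_bracket lsa_leibniz lsa_mulZl scalerBr addrAC.
rewrite pairingZr anchor_appM pairingDr !pairingZr mulrBr opprD.
by rewrite addrACA [pairing xi u * _]mulrC subrr addr0.
Qed.

Lemma Rstar_pairing x xi y : pairing (Rstar x xi) y = - pairing xi (lsa_mul y x).
Proof.
apply: dual_sectionE; split=> [u v|f u].
  by rewrite lsa_mulDl pairingDr opprD.
by rewrite lsa_mulZl pairingZr mulrN.
Qed.

Lemma lsa_d_pairing f x : pairing (lsa_d f) x = anchor_app x f.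
Proof.
apply: dual_sectionE; split=> [u v|g u].
  by rewrite /anchor_app bmap_secD vf_appDl.
by rewrite /anchor_app bmap_secZ vf_appZl.
Qed.

(** Test against the purely covector sections to recover the part in A, and
    against the sections of A to recover the covector part. *)
Lemma phase_omega_inj (e e' : section (phase_bundle A)) :
  (forall e3, phase_omega e e3 = phase_omega e' e3) -> e = e'.
Proof.
move=> ee'; rewrite -(sec_pair_eta e) -(sec_pair_eta e'); congr sec_pair.
  apply: pairing_injr => zeta; have := ee' (sec_pair 0 zeta).
  rewrite /phase_omega sec_fst_pair sec_snd_pair -[0](scale0r 0) !pairingZr.
  by rewrite !mul0r !sub0r => /oppr_inj.
apply: pairing_inj => y; have := ee' (sec_pair y 0).
rewrite /phase_omega sec_fst_pair sec_snd_pair -[0 as X in pairing X](scale0r 0) !pairingZl.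
by rewrite !mul0r !subr0.
Qed.

Definition phase_mul (e1 e2 : section (phase_bundle A)) : section (phase_bundle A) :=
  let x := sec_fst e1 in let xi := sec_snd e1 in
  let y := sec_fst e2 in let eta := sec_snd e2 in
  sec_pair (lsa_mul x y) (lie_derivative x eta - Rstar y xi
    - smooth_cst 2^-1 *: lsa_d (pairing_plus e1 e2)).

Lemma smooth_cst_half f : smooth_cst 2^-1 * f + smooth_cst 2^-1 * f = f.
Proof. by apply: smooth_fun_ext => p /=; rewrite -[LHS]/(2^-1 * f p + 2^-1 * f p); lra. Qed.

(** In omega(e2, [e1, e3]) the term a_A(x)<zeta,y> cancels the one coming from
    rho(e1) omega(e2, e3), while -a_A(z)<xi,y> combines with half of
    a_A(z)(<xi,y> - <eta,x>) into minus half of a_A(z)(<xi,y> + <eta,x>), the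
    pairing of z with the differential term of the product. *)
Lemma phase_mul_presymplectic : is_presymplectic_mul A phase_mul.
Proof.
move=> e1 e2 e3; rewrite /phase_omega /phase_mul /phase_bracket /phase_anchor_app /pairing_plus.
rewrite !sec_fst_pair !sec_snd_pair.
set x := sec_fst e1; set xi := sec_snd e1; set y := sec_fst e2.
set eta := sec_snd e2; set z := sec_fst e3; set zeta := sec_snd e3.
rewrite !(pairingDl, pairingNl, pairingZl) lie_derivative_pairing Rstar_pairing.
rewrite lsa_d_pairing !Lstar_pairing !(anchor_appD, anchor_appN).
(* The constant 1/2 is an opaque element for the ring normalization, so that
   a_A(z)<xi,y> has to be split into halves first. *)
rewrite -[X in _ = _ - (_ - (_ - (X - _)))]smooth_cst_half; ring.
Qed.
End Algebroid.

Theorem proposition3p14 (R : realType) (n : nat) (M : manifold R n)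
    (A : left_symmetric_algebroid M) :
  (exists! star : section (phase_bundle A) -> section (phase_bundle A) ->
                  section (phase_bundle A),
     is_presymplectic_mul A star) /\
  (forall star : section (phase_bundle A) -> section (phase_bundle A) ->
                 section (phase_bundle A),
     is_presymplectic_mul A star ->
     forall (x y : section A) (xi eta : section (dual_bundle A)),
       star (sec_pair x xi) (sec_pair y eta) =
       sec_pair (lsa_mul x y)
         (lie_derivative x eta - Rstar y xi
          - smooth_cst 2^-1 *:
              lsa_d (pairing_plus (sec_pair x xi) (sec_pair y eta)))).
Proof.
have uniq star : is_presymplectic_mul A star -> phase_mul = star.
  move=> Hs; apply/funext => e1; apply/funext => e2.
  by apply: phase_omega_inj => e3; rewrite Hs phase_mul_presymplectic.
split; first by exists phase_mul; split; [exact: phase_mul_presymplectic|exact: uniq].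
by move=> star /uniq <- x y xi eta; rewrite /phase_mul !sec_fst_pair !sec_snd_pair.
Qed.
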